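(* Let $n\ge2$, $m\ge1$, let $V$ be a finite-dimensional complex vector space, let $\rho\colon B_m\to\mathrm{GL}(V)$ be a representation and let $q\in\mathbf{C}^*$. Then there is a representation $\rho'\colon B_{n,m}\to\mathrm{GL}(V)$ with $\rho'(\sigma_i)=1$ for $i=1,\dots,n-1$, $\rho'(\sigma_n^2)=q$, and $\rho'(\sigma_{n+i})=\rho(\sigma_i)$ for $i=1,\dots,m-1$. Set $\rho^{(m)}=\rho'$ and, for $j=m,m-1,\dots,1$, let $\rho^{(j-1)}=(\rho^{(j)})^+$ be the representation of $B_{n,j-1}$ obtained from the representation $\rho^{(j)}$ of $B_{n,j}$ by the construction described in the context. Then $\rho^+_q:=\rho^{(0)}$ is a representation of $B_{n,0}=B_n$ on $V^{\oplus k}$, where $k=(n+m-1)(n+m-2)\cdots(n+1)n$. This gives a one-parameter family of representations $\rho^+_q$, $q\in\mathbf{C}^*$.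
   Context: For $N\ge2$ the braid group $B_N$ has generators $\sigma_1,\dots,\sigma_{N-1}$ with relations $\sigma_i\sigma_j=\sigma_j\sigma_i$ for $|i-j|>1$ and $\sigma_i\sigma_j\sigma_i=\sigma_j\sigma_i\sigma_j$ for $|i-j|=1$ ($B_1$ is trivial). Let $F_N$ be free on $g_1,\dots,g_N$; $F_N\rtimes B_N$ is generated by $F_N$ and $B_N$ subject to the additional relations $g_{i+1}\sigma_i=\sigma_i g_i$, $g_i\sigma_i=\sigma_i g_i g_{i+1}g_i^{-1}$, $g_j\sigma_i=\sigma_i g_j$ for $j\notin\{i,i+1\}$. With $R_i=\begin{bmatrix}0&g_i\\1&1-g_i\end{bmatrix}$, $\phi$ is the homomorphism from $B_N$ to invertible $N\times N$ matrices over $\mathbf{Z}[F_N\rtimes B_N]$ given by $\phi(\sigma_i)=\sigma_i\cdot\mathrm{diag}(I_{i-1},R_i,I_{N-i-1})$ (scalar $\sigma_i$ multiplying each entry on the left). $B_{n,j}\subset B_{n+j}$ is the subgroup of braids in which the first $n$ bottom endpoints are connected to the first $n$ top endpoints; it is generated by $\sigma_1,\dots,\sigma_{n-1},\sigma_n^2,\sigma_{n+1},\dots,\sigma_{n+j-1}$, and $B_{n,0}=B_n$. $B_{n,j-1}$ is a subgroup of $B_{n,j}$ by adding a straight last strand. $F_{n+j-1}$ is identified with the subgroup of $B_{n,j}$ of braids whose first $n+j-1$ strands are straight, freely generated by $g_i=(\sigma_{n+j-1}\cdots\sigma_{i+1})\sigma_i^2(\sigma_{n+j-1}\cdots\sigma_{i+1})^{-1}$,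 $i=1,\dots,n+j-1$, and the subgroup of $B_{n,j}$ generated by $B_{n,j-1}$ and $F_{n+j-1}$ is identified with the subgroup $F_{n+j-1}\rtimes B_{n,j-1}$ of $F_{n+j-1}\rtimes B_{n+j-1}$. Construction: given a representation $\tau$ of $B_{n,j}$ on $W$, $\tau^+\colon B_{n,j-1}\to\mathrm{GL}(W^{\oplus(n+j-1)})$ sends $\beta$ to the block matrix whose $(k,l)$ block is $\tau(\phi(\beta)_{kl})$, with $\tau$ restricted to $F_{n+j-1}\rtimes B_{n,j-1}$ and extended linearly to the group ring (this is a representation of $B_{n,j-1}$). *)

(* Defs.v *)
From HB Require Import structures.
From mathcomp Require Import all_boot all_order all_algebra.
From mathcomp Require Import Rstruct.
From mathcomp Require Import complex.
From Stdlib Require Rdefinitions.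

Set Implicit Arguments.
Unset Strict Implicit.
Unset Printing Implicit Defensive.

Import Order.TTheory GRing.Theory Num.Theory.
Local Open Scope ring_scope.

Notation CC := (complex Rdefinitions.R).

(* Braid words.  A letter (i, true) is sigma_i, (i, false) is sigma_i^-1. *)
Definition letter := (nat * bool)%type.
Definition word := seq letter.

Definition valid (N : nat) (w : word) : bool :=
  all (fun l : letter => (0 < l.1 < N)%N) w.

Inductive beq (N : nat) : word -> word -> Prop :=
| beq_refl u : beq N u u
| beq_sym u v : beq N u v -> beq N v u
| beq_trans u v w : beq N u v -> beq N v w -> beq N u w
| beq_ctx a b u v : valid N a -> valid N b -> beq N u v ->
    beq N (a ++ u ++ b) (a ++ v ++ b)
| beq_free i (e : bool) : (0 < i < N)%N -> beq N [:: (i, e); (i, ~~ e)] [::]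
| beq_comm i j : (0 < i < N)%N -> (0 < j < N)%N -> (1 < `|i - j|)%N ->
    beq N [:: (i, true); (j, true)] [:: (j, true); (i, true)]
| beq_braid i j : (0 < i < N)%N -> (0 < j < N)%N -> `|i - j|%N = 1%N ->
    beq N [:: (i, true); (j, true); (i, true)] [:: (j, true); (i, true); (j, true)].

(* Underlying permutation of strands (positions 0 .. N-1); sigma_i exchanges
   positions i-1 and i.  [endpoint w k] is where the strand starting at
   position k ends. *)
Definition swap_pos (i p : nat) : nat :=
  if p == i.-1 then i else if p == i then i.-1 else p.
Definition endpoint (w : word) (k : nat) : nat :=
  foldl (fun p (l : letter) => swap_pos l.1 p) k w.

(* B_{n,j} inside B_{n+j}: the first n bottom endpoints are connected to the
   first n top endpoints. *)
Definition inBnj (n j : nat) (w : word) : bool :=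
  valid (n + j) w && [forall k : 'I_n, (endpoint w k < n)%N].

(* A representation on CC^D of the subgroup of B_N given by the (beq N-closed)
   set of words P: a multiplicative map constant on beq-classes.
   (Invertibility of the values follows: u u^-1 = 1 in B_N.) *)
Definition is_rep (N : nat) (P : pred word) (D : nat) (r : word -> 'M[CC]_D) : Prop :=
  [/\ r [::] = 1%:M,
      (forall u v, P u -> P v -> r (u ++ v) = r u *m r v) &
      (forall u v, P u -> P v -> beq N u v -> r u = r v)].

(* The matrix phi of the context, with its entries in Z[F_N x| B_N] already
   pushed into the group ring of B_{N+1} through the identification
   F_N x| B_{n,j-1} <= B_{n,j} (sigma_i |-> sigma_i,
   g_i |-> (sigma_N..sigma_(i+1)) sigma_i^2 (sigma_N..sigma_(i+1))^-1).
   Group-ring elements are formal sums: lists of (coefficient, word). *)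
Definition fsum := seq (int * word).

Definition up_word (N i : nat) : word := [seq (k, true) | k <- rev (iota i.+1 (N - i))].
Definition inv_word (w : word) : word := [seq (l.1, ~~ l.2) | l <- rev w].
Definition gw (N i : nat) : word := up_word N i ++ [:: (i, true); (i, true)] ++ inv_word (up_word N i).
Definition gwinv (N i : nat) : word := inv_word (gw N i).

Definition fmat (N : nat) := 'I_N -> 'I_N -> fsum.

Definition fmul (N : nat) (A B : fmat N) : fmat N := fun k l =>
  flatten [seq [seq (a.1 * b.1, a.2 ++ b.2)%R | a <- A k m, b <- B m l] | m <- enum 'I_N].
Definition fid (N : nat) : fmat N := fun k l => if k == l then [:: (1%R, [::])] else [::].

(* phi(sigma_i) = sigma_i . diag(I_(i-1), R_i, I_(N-i-1)),  R_i = [[0, g_i],[1, 1 - g_i]];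
   phi(sigma_i^-1) = phi(sigma_i)^-1 = diag(I, R_i^-1, I) . sigma_i^-1,
   R_i^-1 = [[1 - g_i^-1, 1],[g_i^-1, 0]]. *)
Definition phi_letter (N : nat) (l : letter) : fmat N := fun k l' =>
  let i := l.1 in
  let s := [:: (i, l.2)] in
  let k := val k in let l' := val l' in
  if l.2 then
    if (k == i.-1) && (l' == i.-1) then [::]
    else if (k == i.-1) && (l' == i) then [:: (1%R, s ++ gw N i)]
    else if (k == i) && (l' == i.-1) then [:: (1%R, s)]
    else if (k == i) && (l' == i) then [:: (1%R, s); ((-1)%R, s ++ gw N i)]
    else if k == l' then [:: (1%R, s)] else [::]
  else
    if (k == i.-1) && (l' == i.-1) then [:: (1%R, s); ((-1)%R, gwinv N i ++ s)]
    else if (k == i.-1) && (l' == i) then [:: (1%R, s)]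
    else if (k == i) && (l' == i.-1) then [:: (1%R, gwinv N i ++ s)]
    else if (k == i) && (l' == i) then [::]
    else if k == l' then [:: (1%R, s)] else [::].

Definition phi (N : nat) (w : word) : fmat N :=
  foldr (fun l M => fmul (@phi_letter N l) M) (@fid N) w.

Lemma odiv_proof (N D : nat) (i : 'I_(N * D)) : (i %/ D < N)%N.
Proof.
case: D i => [|D] i; first by case: i => k; rewrite muln0.
by rewrite ltn_divLR.
Qed.
Lemma omod_proof (N D : nat) (i : 'I_(N * D)) : (i %% D < D)%N.
Proof.
case: D i => [|D] i; first by case: i => k; rewrite muln0.
by rewrite ltn_mod.
Qed.
Definition odiv N D (i : 'I_(N * D)) : 'I_N := Ordinal (odiv_proof i).
Definition omod N D (i : 'I_(N * D)) : 'I_D := Ordinal (omod_proof i).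

(* The construction tau |-> tau^+ : from a representation tau of B_{n,j}
   on CC^D to the representation of B_{n,j-1} on (CC^D)^(n+j-1): the
   (k,l) block of tau^+(beta) is tau(phi(beta)_{kl}) (tau extended linearly). *)
Definition plus (n j D : nat) (tau : word -> 'M[CC]_D) : word -> 'M[CC]_((n + j - 1) * D)%N :=
  fun w => \matrix_(a, b)
    ((\sum_(t <- @phi (n + j - 1)%N w (odiv a) (odiv b)) (t.1)%:~R *: tau t.2)
       (omod a) (omod b)).

(* Iterating: step s goes from rho^(m-s) to rho^(m-s-1). *)
Fixpoint iter_dim (n m d s : nat) : nat :=
  match s with
  | 0 => d
  | s'.+1 => ((n + (m - s') - 1) * iter_dim n m d s')%N
  end.

Fixpoint iter_rep (n m d : nat) (rho' : word -> 'M[CC]_d) (s : nat)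
  : word -> 'M[CC]_(iter_dim n m d s) :=
  match s with
  | 0 => rho'
  | s'.+1 => plus n (m - s') (iter_rep n m rho' s')
  end.

(* Main.v *)
(** To show that [plus] preserves the braid relations, the matrix [phi w] is
    not manipulated over a group ring: it acts on families [F k] of functions of
    a word [x], the entry [a] of the group ring acting by right translation
    [F (x ++ a)]. Restricted to functions constant on braid classes, these
    operators satisfy the braid relations because the words [gw N i] satisfy the
    semidirect product relations g_(i+1) s_i = s_i g_i,
    g_i g_(i+1) s_i = s_i g_i g_(i+1) and
    g_j s_i = s_i g_j (j <> i, i+1) in B_(N+1). Applied to
    a matrix coefficient of [tau], extended by zero outside of B_{n,j}, they
    return the entries of [plus tau].

    The initial representation forgets the first [n] strands, applies [rho] to
    the remaining braid of [m] strands, and multiplies by [q] to the power of the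
    total winding number between forgotten and remaining strands. *)

Require Import Defs.
From HB Require Import structures.
From mathcomp Require Import all_boot all_order all_algebra.
From mathcomp Require Import Rstruct.
From mathcomp Require Import complex.
From mathcomp Require Import zify ring.
From Stdlib Require Import Setoid Morphisms.
Import Order.TTheory GRing.Theory Num.Theory.

Set Implicit Arguments.
Unset Strict Implicit.
Unset Printing Implicit Defensive.

Local Open Scope nat_scope.

(** * Braid words up to equivalence, and inverses *)

Lemma valid_cat N u v : valid N (u ++ v) = valid N u && valid N v.
Proof. exact: all_cat. Qed.

Lemma beq_valid N u v : beq N u v -> valid N u = valid N v.
Proof.
elim=> //= {u v}.
- by move=> u v w _ -> _ ->.
- by move=> a b u v _ _ _ uv; rewrite !valid_cat uv.
- by move=> i e ->.
- by move=> i j -> ->.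
- by move=> i j -> ->.
Qed.

(* Unlike [beq], whose context rule asks for valid contexts, this is a
   congruence for concatenation of arbitrary words. *)
Definition veq N (u v : word) : Prop :=
  valid N u = valid N v /\ (valid N u -> beq N u v).

Lemma beq_veq N u v : beq N u v -> veq N u v.
Proof. by move=> uv; split=> //; apply: beq_valid. Qed.

Lemma veq_refl N u : veq N u u.
Proof. by split=> // _; apply: beq_refl. Qed.
#[local] Hint Resolve veq_refl : core.

Add Parametric Relation N : word (veq N)
  reflexivity proved by (@veq_refl N)
  symmetry proved by (fun u v H => conj (esym H.1)
    (fun v_ok => beq_sym (H.2 (etrans H.1 v_ok))))
  transitivity proved by (fun u v w H K => conj (etrans H.1 K.1)
    (fun u_ok => beq_trans (H.2 u_ok) (K.2 (etrans (esym H.1) u_ok))))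
  as veq_rel.

Add Parametric Morphism N : (@cat letter) with signature
  veq N ==> veq N ==> veq N as veq_cat.
Proof.
move=> u u' [uu' Hu] v v' [vv' Hv]; split; first by rewrite !valid_cat uu' vv'.
rewrite valid_cat => /andP [u_ok v_ok].
have /= Eu := @beq_ctx N [::] v u u' isT v_ok (Hu u_ok).
apply: beq_trans Eu _; rewrite uu' in u_ok.
by have := @beq_ctx N u' [::] v v' u_ok isT (Hv v_ok); rewrite !cats0.
Qed.

Lemma inv_word_cat u v : inv_word (u ++ v) = inv_word v ++ inv_word u.
Proof. by rewrite /inv_word rev_cat map_cat. Qed.

Lemma inv_wordK : involutive inv_word.
Proof.
move=> u; rewrite /inv_word -map_rev revK -map_comp -[RHS]map_id.
by apply: eq_map => -[i e] /=; rewrite negbK.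
Qed.

Lemma valid_inv N u : valid N (inv_word u) = valid N u.
Proof. by rewrite /valid all_map -all_rev revK. Qed.

Lemma veq_mulV N u : valid N u -> veq N (u ++ inv_word u) [::].
Proof.
elim: u => [_|[i e] u IH]; first reflexivity.
rewrite /valid /= => /andP[i_ok u_ok].
have -> : (i, e) :: u ++ inv_word ((i, e) :: u)
          = [:: (i, e)] ++ (u ++ inv_word u) ++ [:: (i, ~~ e)].
  by rewrite -[(i, e) :: u]cat1s inv_word_cat catA.
rewrite (IH u_ok) /=.
exact: beq_veq (beq_free e i_ok).
Qed.

Lemma veq_Vmul N u : valid N u -> veq N (inv_word u ++ u) [::].
Proof.
by rewrite -valid_inv => /veq_mulV; rewrite inv_wordK.
Qed.

Lemma veq_mulVK N u w : valid N u -> veq N (u ++ inv_word u ++ w) w.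
Proof. by move=> u_ok; rewrite catA (veq_mulV u_ok). Qed.

Lemma veq_mulKV N u w : valid N u -> veq N (inv_word u ++ u ++ w) w.
Proof. by move=> u_ok; rewrite catA (veq_Vmul u_ok). Qed.

Local Notation wcomm N u v := (veq N (u ++ v) (v ++ u)).

Lemma wcomm_cat N u v w : wcomm N u v -> wcomm N u w -> wcomm N u (v ++ w).
Proof. by move=> uv uw; rewrite catA uv -catA uw catA. Qed.

Lemma wcomm_inv N u v : valid N v -> wcomm N u v -> wcomm N u (inv_word v).
Proof.
move=> v_ok uv.
transitivity (inv_word v ++ (u ++ v) ++ inv_word v).
  by rewrite uv -catA (veq_mulKV _ v_ok).
by rewrite -catA (veq_mulV v_ok) cats0.
Qed.

(** * Relations between the generators [gw N i] and [sg k] in B_(N+1) *)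

Section PureGenerators.
Variable N : nat.
Local Notation "u =~ v" := (veq N.+1 u v) (at level 70).
Local Notation sg i := [:: (i, true)].

Lemma sg_comm i j : (0 < i <= N)%N -> (0 < j <= N)%N -> (1 < `|i - j|)%N ->
  wcomm N.+1 (sg i) (sg j).
Proof. by move=> i_ok j_ok ij; apply/beq_veq/beq_comm. Qed.

Lemma sg_braid i : (0 < i < N)%N ->
  sg i ++ sg i.+1 ++ sg i =~ sg i.+1 ++ sg i ++ sg i.+1.
Proof. move=> iN; apply/beq_veq/beq_braid; lia. Qed.

Lemma valid_up i : valid N.+1 (up_word N i).
Proof.
rewrite /valid /up_word all_map all_rev; apply/allP => k /=.
rewrite mem_iota; lia.
Qed.

Lemma up_wordS i : (i < N)%N -> up_word N i = up_word N i.+1 ++ sg i.+1.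
Proof.
move=> iN; rewrite /up_word (_ : N - i = (N - i.+1).+1)%N /=; last lia.
by rewrite rev_cons -cats1 map_cat.
Qed.

Lemma valid_gw i : (0 < i <= N)%N -> valid N.+1 (gw N i).
Proof.
by move=> i_ok; rewrite /gw !valid_cat valid_inv valid_up /= !andbT andbb.
Qed.

Lemma up_comm k i : (0 < k)%N -> (k.+1 < i.+1)%N -> (i <= N)%N ->
  wcomm N.+1 (sg k) (up_word N i).
Proof.
(* Induction on the length [N - i] of the word, with [i] decreasing from [N]. *)
move=> k0 + iN; have -> : i = (N - (N - i))%N by lia.
elim: (N - i)%N (leq_subr i N) => [|d IH] dN kd.
  by rewrite /up_word subn0 subnn.
rewrite up_wordS; last lia.
rewrite (_ : (N - d.+1).+1 = N - d)%N; last lia.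
apply: wcomm_cat; first by apply: IH; lia.
apply: sg_comm; lia.
Qed.

(** The letter passes everything above [k.+1], the braid relation on s_k s_(k+1) s_k turns it into
    s_(k+1), and this commutes with all letters below [k]. *)
Lemma up_shift k i : (0 < k < N)%N -> (i < k)%N ->
  sg k ++ up_word N i =~ up_word N i ++ sg k.+1.
Proof.
move=> kN ik; have -> : i = (k.-1 - (k.-1 - i))%N by lia.
elim: (k.-1 - i)%N (leq_subr i k.-1) => [|d IH] dk.
  rewrite subn0 up_wordS; last lia.
  rewrite (_ : k.-1.+1 = k); last lia.
  rewrite up_wordS; last lia.
  have kU : sg k ++ up_word N k.+1 =~ up_word N k.+1 ++ sg k by apply: up_comm; lia.
  have braid := @sg_braid k kN.
  by rewrite -!catA [sg k ++ _]catA kU -(catA _ (sg k)) braid.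
rewrite up_wordS; last lia.
rewrite (_ : (k.-1 - d.+1).+1 = k.-1 - d)%N; last lia.
have kd : sg k.+1 ++ sg (k.-1 - d) =~ sg (k.-1 - d) ++ sg k.+1.
  by apply: sg_comm; lia.
by rewrite [sg k ++ _]catA IH -?catA ?kd //; lia.
Qed.

(** If [k] is below [i], the letter commutes with each factor of [gw N i]. If it is above, crossing
    [up_word N i] turns it into s_(k+1), which commutes with s_i^2 and is turned back by the inverse
    word. *)
Lemma gw_sg_far i k : (0 < i <= N)%N -> (0 < k < N)%N -> k != i -> k.+1 != i ->
  wcomm N.+1 (sg k) (gw N i).
Proof.
move=> i_ok k_ok ki kSi; have [ik|ik] := ltnP i k; last first.
  have ? := valid_up i; have ? : wcomm N.+1 (sg k) (up_word N i) by apply: up_comm; lia.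
  have ? : wcomm N.+1 (sg k) (sg i) by apply: sg_comm; lia.
  by rewrite /gw -[[:: _; _]]/(sg i ++ sg i); do ![apply: wcomm_cat | apply: wcomm_inv].
have U_ok := valid_up i.
have kU := up_shift k_ok ik.
have kV : inv_word (up_word N i) ++ sg k =~ sg k.+1 ++ inv_word (up_word N i).
  transitivity (inv_word (up_word N i) ++ (sg k ++ up_word N i) ++ inv_word (up_word N i)).
    by rewrite -catA (veq_mulV U_ok) cats0.
  by rewrite kU -catA (veq_mulKV _ U_ok).
have ki2 : wcomm N.+1 (sg k.+1) (sg i ++ sg i) by apply: wcomm_cat; apply: sg_comm; lia.
rewrite /gw -[[:: _; _]]/(sg i ++ sg i).
move: (up_word N i) (inv_word _) (sg i ++ sg i) kU kV ki2 => U V w kU kV kw.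
by rewrite -!catA kV (catA w) -kw -!catA (catA (sg k)) kU -!catA.
Qed.

Lemma gwE i : (i < N)%N -> gw N i = up_word N i.+1 ++ sg i.+1 ++ sg i ++ sg i ++
  inv_word (sg i.+1) ++ inv_word (up_word N i.+1).
Proof. by move=> iN; rewrite /gw up_wordS // inv_word_cat -!catA. Qed.

Section AdjacentRelations.
(** In the application [s], [t], [U] are s_i, s_(i+1) and [up_word N i.+1], so that [a] is [gw N i]
    and [b] is [gw N i.+1]. *)
Variables s t U : word.
Hypotheses (t_ok : valid N.+1 t) (U_ok : valid N.+1 U) (sU : wcomm N.+1 s U).
Hypothesis sts : s ++ t ++ s =~ t ++ s ++ t.
Let a := U ++ t ++ s ++ s ++ inv_word t ++ inv_word U.
Let b := U ++ t ++ t ++ inv_word U.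

Let stsK w : s ++ t ++ s ++ w =~ t ++ s ++ t ++ w.
Proof. by have := sts; rewrite !catA => H; rewrite -!catA !catA H. Qed.

(** After [s] has passed [U], two braid moves turn s t s s into t t s t, whose last letter cancels
    the inverse of [t]. *)
Lemma adjacent_slide : b ++ s =~ s ++ a.
Proof.
have sV : s ++ inv_word U =~ inv_word U ++ s by apply: wcomm_inv.
rewrite /a /b -!catA -sV (catA s U) sU -!catA stsK.
rewrite stsK (veq_mulVK _ t_ok); reflexivity.
Qed.

(** The product [a ++ b] collapses to U t s s t U^-1, and two braid moves carry [s] through t s s
    t. *)
Lemma adjacent_comm : a ++ b ++ s =~ s ++ a ++ b.
Proof.
have sV : s ++ inv_word U =~ inv_word U ++ s by apply: wcomm_inv.
rewrite /a /b -!catA !(veq_mulKV _ U_ok) !(veq_mulKV _ t_ok) -sV.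
rewrite (catA s U) sU -!catA stsK.
by rewrite (stsK (s ++ _)).
Qed.
End AdjacentRelations.

Lemma gw_slide i : (0 < i < N)%N -> gw N i.+1 ++ sg i =~ sg i ++ gw N i.
Proof.
move=> iN; rewrite (@gwE i); last lia.
apply: (@adjacent_slide (sg i) (sg i.+1) (up_word N i.+1));
  [|exact: valid_up|apply: up_comm|exact: sg_braid]; rewrite /valid /=; lia.
Qed.

(** Given [gw_slide], this is the relation g_i s_i = s_i g_i g_(i+1) g_i^-1 freed of its inverse. *)
Lemma gw_adj_comm i : (0 < i < N)%N ->
  gw N i ++ gw N i.+1 ++ sg i =~ sg i ++ gw N i ++ gw N i.+1.
Proof.
move=> iN; rewrite (@gwE i); last lia.
apply: (@adjacent_comm (sg i) (sg i.+1) (up_word N i.+1));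
  [|exact: valid_up|apply: up_comm|exact: sg_braid]; rewrite /valid /=; lia.
Qed.

End PureGenerators.

Local Open Scope ring_scope.

(** * The operators attached to [phi], and their braid relations *)

Section MatrixAction.
Variables (M : comNzRingType) (N : nat).
Implicit Types (F : nat -> word -> M) (w u v x y : word).

(* [F k x] stands for the value of a column of group-ring elements, multiplied
   on the left by [x] and evaluated by some class function, at index [k]. *)
Definition ract i (s g : word) F (k : nat) x : M :=
  if k == i.-1 then F i (x ++ s ++ g)
  else if k == i then F i.-1 (x ++ s) + F i (x ++ s) - F i (x ++ s ++ g)
  else F k (x ++ s).

(** The operator of R_i^-1 s_i^-1: here [s] and [g] stand for s_i^-1 and g_i^-1, and [g] comes
    first. *)
Definition ract_inv i (s g : word) F (k : nat) x : M :=
  if k == i.-1 then F i.-1 (x ++ s) - F i.-1 (x ++ g ++ s) + F i (x ++ s)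
  else if k == i then F i.-1 (x ++ g ++ s)
  else F k (x ++ s).

Definition lact (l : letter) : (nat -> word -> M) -> nat -> word -> M :=
  if l.2 then ract l.1 [:: l] (gw N l.1) else ract_inv l.1 [:: l] (gwinv N l.1).

Definition wact w F := foldr lact F w.

Definition class_fun F := forall k x y, veq N.+1 x y -> F k x = F k y.

Lemma lact_ext l F G : F =2 G -> lact l F =2 lact l G.
Proof. by move=> FG k x; rewrite /lact /ract /ract_inv; case: l.2; rewrite !FG. Qed.

Lemma wact_ext w F G : F =2 G -> wact w F =2 wact w G.
Proof. by move=> FG; elim: w => //= l w; apply: lact_ext. Qed.

Lemma wact_cat u v F : wact (u ++ v) F = wact u (wact v F).
Proof. exact: foldr_cat. Qed.

Lemma lact_class l F : class_fun F -> class_fun (lact l F).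
Proof.
move=> hF k x y xy; rewrite /lact /ract /ract_inv.
by case: l.2; repeat case: ifP => _; repeat congr (_ + _); try congr (- _); apply: hF; rewrite xy.
Qed.

Lemma wact_class w F : class_fun F -> class_fun (wact w F).
Proof. by move=> hF; elim: w => //= l w; apply: lact_class. Qed.

Lemma sum_phi_letter F x (l : letter) (k : 'I_N) : (0 < l.1 < N)%N ->
  \sum_m \sum_(a <- phi_letter l k m) F m (x ++ a.2) *~ a.1 = lact l F k x.
Proof.
case: l => [[//|i] e] /= i_ok; have i'_ok : (i < N)%N by apply: ltnW.
pose i0 := Ordinal i'_ok; pose i1 := Ordinal (i_ok : i.+1 < N)%N.
have neq1 : (i.+1 == i) = false by lia.
have neq2 : (i == i.+1) = false by lia.
have i10 : i1 != i0 by rewrite -val_eqE /= neq1.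
have [ki|ki] := boolP ((k == i0) || (k == i1)).
  rewrite (bigD1 i0) //= (bigD1 i1) //=.
  rewrite [X in _ + (_ + X)]big1 ?addr0 => [|m /andP[m0 m1]].
    by case/orP: ki => /eqP->; case: e; rewrite /phi_letter /lact /ract /ract_inv /= ?eqxx ?neq1
      ?neq2 /= !(big_cons, big_nil) /=; ring.
  rewrite -!val_eqE /= in m0 m1.
  by case/orP: ki => /eqP->; case: e; rewrite /phi_letter /= ?eqxx ?neq1 ?neq2
    ?(negPf m0) ?(negPf m1) /= ?[_ == nat_of_ord m]eq_sym ?(negPf m0) ?(negPf m1) big_nil.
rewrite negb_or -!val_eqE /= in ki; case/andP: ki => /negPf k0 /negPf k1.
rewrite (bigD1 k) //= [X in _ + X]big1 ?addr0 => [|m mk].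
  by case: e; rewrite /phi_letter /lact /ract /ract_inv /= k0 k1 eqxx /=
    !(big_cons, big_nil) /=; ring.
rewrite -val_eqE eq_sym /= in mk.
by case: e; rewrite /phi_letter /= k0 k1 (negPf mk) /= big_nil.
Qed.

Lemma sum_fmul F x (A B : fmat N) k l :
  \sum_(t <- fmul A B k l) F l (x ++ t.2) *~ t.1 =
  \sum_m \sum_(a <- A k m) (\sum_(b <- B m l) F l ((x ++ a.2) ++ b.2) *~ b.1) *~ a.1.
Proof.
rewrite /fmul big_flatten /= big_map big_enum; apply: eq_bigr => m _.
rewrite big_allpairs_dep; apply: eq_bigr => a _; rewrite mulrz_suml.
by apply: eq_bigr => b _ /=; rewrite catA -mulrzA mulrC.
Qed.

(** An entry of the left factor is absorbed into the base point [x], so matrix products become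
    compositions of operators; hence the induction is over all [x]. *)
Lemma sum_phi F x w (k : 'I_N) : valid N w ->
  \sum_l \sum_(t <- phi w k l) F l (x ++ t.2) *~ t.1 = wact w F k x.
Proof.
elim: w x k => [|l w IH] x k; rewrite /valid /=.
  move=> _; rewrite (bigD1 k) //= [X in _ + X]big1 => [|l lk].
    by rewrite /phi /= /fid eqxx big_seq1 /= cats0 mulr1z addr0.
  by rewrite /phi /= /fid eq_sym (negPf lk) big_nil.
case/andP=> l_ok w_ok; rewrite -sum_phi_letter //.
under eq_bigr do rewrite sum_fmul.
rewrite exchange_big; apply: eq_bigr => m _.
rewrite exchange_big; apply: eq_bigr => a _.
by rewrite -mulrz_suml IH.
Qed.

Lemma class_fun_mul F u v : class_fun F -> veq N.+1 u v ->
  forall k x, F k (x ++ u) = F k (x ++ v).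
Proof. by move=> hF uv k x; apply: hF; rewrite uv. Qed.

Lemma class_fun_mul1 F u : class_fun F -> veq N.+1 u [::] ->
  forall k x, F k (x ++ u) = F k x.
Proof. by move=> hF uv k x; apply: hF; rewrite uv cats0. Qed.

Lemma ractK i (s g s' g' : word) F : class_fun F -> (0 < i)%N ->
  veq N.+1 (s ++ s') [::] -> veq N.+1 (g ++ g') [::] ->
  ract i s g (ract_inv i s' g' F) =2 F.
Proof.
case: i => // p hF _ ss gg k x.
have sggs : veq N.+1 (s ++ g ++ g' ++ s') [::] by rewrite (catA g) gg.
have neq : (p.+1 == p) = false by lia.
rewrite /ract /ract_inv /= !eqxx neq -!catA.
rewrite !(class_fun_mul1 hF sggs) !(class_fun_mul1 hF ss).
by case: (k =P p) => [->|_]; [|case: (k =P p.+1) => [->|_]]; ring.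
Qed.

Lemma ract_invK i (s g s' g' : word) F : class_fun F -> (0 < i)%N ->
  veq N.+1 (s' ++ s) [::] -> veq N.+1 (g' ++ g) [::] ->
  ract_inv i s' g' (ract i s g F) =2 F.
Proof.
case: i => // p hF _ ss gg k x.
have ssg : veq N.+1 (s' ++ s ++ g) g by rewrite catA ss.
have gssg : veq N.+1 (g' ++ s' ++ s ++ g) [::] by rewrite ssg.
have neq : (p.+1 == p) = false by lia.
rewrite /ract /ract_inv /= !eqxx neq -!catA.
rewrite !(class_fun_mul1 hF gssg) !(class_fun_mul hF ssg).
rewrite !(class_fun_mul1 hF ss).
by case: (k =P p) => [->|_]; [|case: (k =P p.+1) => [->|_]]; ring.
Qed.

(** The two blocks act on disjoint pairs of indices, so only the commutation of the words has to be
    checked. *)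
Lemma ract_comm i j (s g t h : word) F : class_fun F ->
  (0 < i)%N -> (i.+1 < j)%N ->
  veq N.+1 (s ++ t) (t ++ s) -> veq N.+1 (t ++ g) (g ++ t) ->
  veq N.+1 (s ++ h) (h ++ s) ->
  ract i s g (ract j t h F) =2 ract j t h (ract i s g F).
Proof.
case: i j => [|i] // [|j] // hF _ ij st gt hs k x.
have tsg : veq N.+1 (t ++ s ++ g) (s ++ g ++ t) by rewrite catA -st -catA gt.
have ths : veq N.+1 (t ++ h ++ s) (s ++ t ++ h) by rewrite -hs catA -st -catA.
rewrite /ract /= -!catA.
rewrite !(class_fun_mul hF tsg) !(class_fun_mul hF ths) -!(class_fun_mul hF st).
have [->|ki] := eqVneq k i.
  by rewrite !ifN_eq //; lia.
have [->|ki1] := eqVneq k i.+1.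
  by rewrite !ifN_eq //; lia.
by case: (eqVneq k j) => [|kj]; [|case: (eqVneq k j.+1) => [|kj1]];
  rewrite ?(negPf ki) ?(negPf ki1) // !ifN_eq //; lia.
Qed.

(** Here [a], [b] play g_i, g_(i+1). The auxiliary equations bring words from the two sides to the
    common forms s t s, s t s a and s t s a b; a 3 by 3 matrix identity remains. *)
Lemma ract_braid i (s t a b : word) F : class_fun F -> (0 < i)%N ->
  veq N.+1 (s ++ t ++ s) (t ++ s ++ t) -> veq N.+1 (t ++ a) (a ++ t) ->
  veq N.+1 (b ++ s) (s ++ a) -> veq N.+1 (a ++ b ++ s) (s ++ a ++ b) ->
  ract i s a (ract i.+1 t b (ract i s a F)) =2
  ract i.+1 t b (ract i s a (ract i.+1 t b F)).
Proof.
case: i => // p hF _ sts ta bs abs k x.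
have tstK w : veq N.+1 (t ++ s ++ t ++ w) (s ++ t ++ s ++ w).
  by have := sts; rewrite !catA => tst; rewrite -!catA !catA tst.
have tbst : veq N.+1 (t ++ b ++ s ++ t) (s ++ t ++ s ++ a).
  by rewrite (catA b) bs -(catA s) -ta tstK.
have stbs : veq N.+1 (s ++ t ++ b ++ s) (s ++ t ++ s ++ a) by rewrite bs.
have satbs : veq N.+1 (s ++ a ++ t ++ b ++ s) (s ++ t ++ s ++ a ++ b).
  by rewrite (catA a) -ta -(catA t) abs.
have tbstb : veq N.+1 (t ++ b ++ s ++ t ++ b) (s ++ t ++ s ++ a ++ b).
  by have := tbst; rewrite !catA => ->.
have tsatb : veq N.+1 (t ++ s ++ a ++ t ++ b) (s ++ t ++ s ++ a ++ b).
  by rewrite (catA a) -ta -(catA t) tstK.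
have neqs : ((p == p.+1) = false) * ((p == p.+2) = false) * ((p.+1 == p) = false) *
  ((p.+2 == p) = false) by do !split; lia.
rewrite /ract /= ?eqSS !eqxx ?neqs -!catA.
rewrite ?(class_fun_mul hF tbst) ?(class_fun_mul hF stbs) ?(class_fun_mul hF satbs).
rewrite ?(class_fun_mul hF tbstb) ?(class_fun_mul hF tsatb) -?(class_fun_mul hF sts).
have [->|_] := eqVneq k p.
  by rewrite ?eqSS ?eqxx ?neqs.
have [_|_] := eqVneq k p.+1; first ring.
by case: eqVneq => _; ring.
Qed.

(** The induction is over all class functions, because in the context rule [wact b F] takes the
    place of [F]. *)
Lemma wact_beq F u v : class_fun F -> beq N u v -> wact u F =2 wact v F.
Proof.
move=> + uv; elim: uv F => {u v} //.
- by move=> u v _ IH F hF k x; rewrite IH.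
- by move=> u v w _ IHu _ IHv F hF k x; rewrite IHu // IHv.
- move=> a b u v _ _ _ IH F hF; rewrite !wact_cat; apply: wact_ext.
  by apply: IH; apply: wact_class.
- move=> i e i_ok F hF; rewrite /wact /= /lact /=.
  have [s_ok g_ok] : valid N.+1 [:: (i, true)] /\ valid N.+1 (gw N i).
    by split; [rewrite /valid /=|apply: valid_gw]; lia.
  case: e => /=; [apply: ractK | apply: ract_invK] => //; try lia.
  + exact: (veq_mulV s_ok).
  + exact: (veq_mulV g_ok).
  + exact: (veq_Vmul s_ok).
  + exact: (veq_Vmul g_ok).
- have comm i j F : (0 < i < N)%N -> (0 < j < N)%N -> (i.+1 < j)%N -> class_fun F ->
      wact [:: (i, true); (j, true)] F =2 wact [:: (j, true); (i, true)] F.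
    move=> i_ok j_ok ij hF; rewrite /wact /= /lact /=; apply: ract_comm => //.
    + lia.
    + apply: sg_comm; lia.
    + apply: gw_sg_far; lia.
    + apply: gw_sg_far; lia.
  move=> i j i_ok j_ok ij F hF k x; have [lt_ij|le_ji] := ltnP i j.
    by apply: comm => //; lia.
  by symmetry; apply: comm => //; lia.
have braid i F : (0 < i)%N -> (i.+1 < N)%N -> class_fun F ->
    wact [:: (i, true); (i.+1, true); (i, true)] F =2
    wact [:: (i.+1, true); (i, true); (i.+1, true)] F.
  move=> i_ok j_ok hF; rewrite /wact /= /lact /=; apply: ract_braid => //.
  + apply: sg_braid; lia.
  + apply: gw_sg_far; lia.
  + apply: gw_slide; lia.
  + apply: gw_adj_comm; lia.
move=> i j i_ok j_ok ij F hF k x.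
have [E|E] : j = i.+1 \/ i = j.+1 by lia.
  by subst; apply: braid => //; lia.
by subst; symmetry; apply: braid => //; lia.
Qed.

End MatrixAction.

(** * Endpoints of strands and membership in B_{n,j} *)

Lemma swap_posK i : involutive (swap_pos i).
Proof. by move=> p; rewrite /swap_pos; repeat case: ifP; lia. Qed.

Lemma swap_posE p : ((swap_pos p.+1 p = p.+1) * (swap_pos p.+1 p.+1 = p) *
  (swap_pos p.+1 p.+2 = p.+2) * (swap_pos p.+2 p = p))%type.
Proof. by rewrite /swap_pos /=; do !split; repeat case: ifP; lia. Qed.

Lemma swap_pos_id i p : p != i.-1 -> p != i -> swap_pos i p = p.
Proof. by move=> /negPf p1 /negPf p2; rewrite /swap_pos p1 p2. Qed.

Lemma swap_pos_braid i k : (0 < i)%N ->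
  swap_pos i (swap_pos i.+1 (swap_pos i k)) =
  swap_pos i.+1 (swap_pos i (swap_pos i.+1 k)).
Proof.
case: i => // p _.
have [->|k0] := eqVneq k p; first by rewrite !swap_posE.
have [->|k1] := eqVneq k p.+1; first by rewrite !swap_posE.
have [->|k2] := eqVneq k p.+2; first by rewrite !swap_posE.
by rewrite !(@swap_pos_id _ k).
Qed.

Lemma endpoint_cat u v k : endpoint (u ++ v) k = endpoint v (endpoint u k).
Proof. exact: foldl_cat. Qed.

Lemma endpoint_inv u : cancel (endpoint u) (endpoint (inv_word u)).
Proof.
elim: u => [|l u IH] k //; rewrite -[l :: u]cat1s inv_word_cat !endpoint_cat IH.
by rewrite /= swap_posK.
Qed.

Lemma endpoint_gw N i k : endpoint (gw N i) k = k.
Proof.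
(* Endpoints ignore signs, so the square of a letter can be read as a letter followed by its
   inverse. *)
rewrite /gw -[[:: _; _]]/([:: (i, true)] ++ inv_word [:: (i, false)]) !endpoint_cat.
by rewrite (endpoint_inv [:: (i, false)]) endpoint_inv.
Qed.

Lemma endpoint_gwinv N i k : endpoint (gwinv N i) k = k.
Proof. by have := endpoint_inv (gw N i) k; rewrite endpoint_gw. Qed.

Lemma beq_endpoint N u v : beq N u v -> endpoint u =1 endpoint v.
Proof.
elim=> {u v} //=.
- by move=> u v _ uv k; rewrite uv.
- by move=> u v w _ uv _ vw k; rewrite uv.
- by move=> a b u v _ _ _ uv k; rewrite !endpoint_cat uv.
- by move=> i e _ k; rewrite /= swap_posK.
- by move=> i j i_ok j_ok ij k; rewrite /= /swap_pos; repeat case: ifP; lia.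
- move=> i j i_ok j_ok ij k; have [E|E] : j = i.+1 \/ i = j.+1 by lia.
    by subst; rewrite /= swap_pos_braid; lia.
  by subst; rewrite /= swap_pos_braid; lia.
Qed.

Lemma inBnj_veq n j u v : veq (n + j) u v -> inBnj n j u = inBnj n j v.
Proof.
rewrite /inBnj => -[uv_ok uv]; rewrite -uv_ok.
case: (boolP (valid _ u)) => //= /uv/beq_endpoint Euv.
by apply: eq_forallb => k; rewrite Euv.
Qed.

Lemma inBnj_cat n j u v : inBnj n j u -> inBnj n j v -> inBnj n j (u ++ v).
Proof.
case/andP=> u_ok /forallP u_n /andP[v_ok /forallP v_n].
rewrite /inBnj valid_cat u_ok v_ok /=; apply/forallP => k.
by rewrite endpoint_cat; exact: v_n (Ordinal (u_n k)).
Qed.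

(** * Words occurring in the entries of [phi] *)

Section Support.
Variable N : nat.

Lemma phi_letter_support (l : letter) (k m : 'I_N) (t : int * word) :
  (0 < l.1 < N)%N -> t \in phi_letter l k m ->
  valid N.+1 t.2 /\ endpoint t.2 =1 endpoint [:: l].
Proof.
case: l => i e /= i_ok; set s := [:: (i, e)].
have s_ok : valid N.+1 s by rewrite /s /valid /=; lia.
have g_ok : valid N.+1 (gw N i) by apply: valid_gw; lia.
have g'_ok : valid N.+1 (gwinv N i) by rewrite valid_inv.
have cat_s z : (i, e) :: z = s ++ z by [].
rewrite /phi_letter /= -/s !cat_s.
move: (gw N i) (gwinv N i) g_ok g'_ok (endpoint_gw N i) (endpoint_gwinv N i)
  => g g' g_ok g'_ok gE g'E.
move: s {cat_s} s_ok => s s_ok.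
case: e => /=; repeat case: ifP => _; rewrite ?inE // => H;
  repeat case/orP: H => H; move/eqP: H => -> /=;
  by split=> [|x]; rewrite ?valid_cat ?s_ok ?g_ok ?g'_ok // ?endpoint_cat ?gE ?g'E.
Qed.

(** The words [gw N i] are pure, so they do not change the permutation. This is what places the
    entries of [phi w] in B_{n,j} when [w] lies in B_{n,j-1}. *)
Lemma phi_support w (k m : 'I_N) (t : int * word) :
  valid N w -> t \in phi w k m -> valid N.+1 t.2 /\ endpoint t.2 =1 endpoint w.
Proof.
elim: w k t => [|l w IH] k t; rewrite /valid /=.
  by rewrite /phi /= /fid => _; case: ifP => _; rewrite ?inE // => /eqP->.
case/andP=> l_ok w_ok /flattenP[_ /mapP[p _ ->]] /allpairsP[[a b] /= [a_in b_in ->]] /=.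
have [a_ok aE] := phi_letter_support l_ok a_in.
have [b_ok bE] := IH _ _ w_ok b_in.
by split=> [|x]; [rewrite all_cat; apply/andP | rewrite endpoint_cat aE bE].
Qed.

End Support.

(** * The construction [plus] preserves representations *)

Lemma odiv_omod_inj N D : injective (fun c : 'I_(N * D) => (odiv c, omod c)).
Proof.
move=> a b [ab_div ab_mod]; apply: val_inj.
by rewrite /= (divn_eq a D) (divn_eq b D) ab_div ab_mod.
Qed.

Lemma sum_odiv_omod (V : nmodType) N D (f : 'I_N -> 'I_D -> V) :
  \sum_(c < N * D) f (odiv c) (omod c) = \sum_m \sum_e f m e.
Proof.
rewrite pair_big (reindex (fun c : 'I_(N * D) => (odiv c, omod c))) //=.
apply/onW_bij/inj_card_bij; first exact: odiv_omod_inj.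
by rewrite card_prod !card_ord.
Qed.

Section Plus.
Variables (n j D : nat) (tau : word -> 'M[CC]_D).
Hypotheses (j_gt0 : (0 < j)%N) (tau_rep : is_rep (n + j) (inBnj n j) tau).
Local Notation N := (n + j - 1)%N.
Local Notation block w := (fun k l : 'I_N =>
  \sum_(t <- phi w k l) (t.1)%:~R *: tau t.2).

(** The test on [k] selects column [l] of [phi]. The default 0 gives a class function on all words,
    although [tau] is constrained only on B_{n,j}. *)
Definition coeff_fun (l : nat) (e f : 'I_D) (k : nat) (x : word) : CC :=
  if (k == l) && inBnj n j x then tau x e f else 0.

Lemma coeff_fun_class l e f : class_fun N (coeff_fun l e f).
Proof.
(* The truncated subtraction in [N] is harmless because [j] is positive. *)
rewrite /class_fun (_ : N.+1 = n + j)%N; last lia.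
move=> k x y xy; rewrite /coeff_fun (inBnj_veq xy).
case: ifP => // /andP[_ y_in]; case: tau_rep => _ _ tau_beq.
rewrite (tau_beq x y) ?(inBnj_veq xy) //.
by apply: xy.2; have := y_in; rewrite -(inBnj_veq xy) => /andP[].
Qed.

Lemma inBnj_phi w (k l : 'I_N) t : inBnj n (j - 1) w -> t \in phi w k l -> inBnj n j t.2.
Proof.
rewrite /inBnj addnBA // => /andP[w_ok /forallP w_n] /(phi_support w_ok)[].
rewrite (_ : N.+1 = n + j)%N; last lia.
by move=> -> Et; apply/forallP => p; rewrite Et; apply: w_n.
Qed.

Lemma block_wact w k l e f : inBnj n (j - 1) w ->
  (block w k l) e f = wact N w (coeff_fun l e f) k [::].
Proof.
move=> w_in; have w_ok : valid N w by have := w_in; rewrite /inBnj addnBA // => /andP[].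
rewrite -sum_phi // (bigD1 l) //= [X in _ + X]big1 ?addr0 => [|m ml].
  rewrite summxE; apply: eq_big_seq => t t_in.
  by rewrite /coeff_fun eqxx (inBnj_phi w_in t_in) mxE mulrzl.
by apply: big1 => t _; rewrite /coeff_fun val_eqE (negPf ml) mul0rz.
Qed.

Lemma block_cat u v k l : inBnj n (j - 1) u -> inBnj n (j - 1) v ->
  block (u ++ v) k l = \sum_m block u k m *m block v m l.
Proof.
move=> u_in v_in; apply/matrixP => e f; rewrite block_wact ?inBnj_cat // wact_cat.
have [u_ok v_ok] : valid N u /\ valid N v.
  by move: u_in v_in; rewrite /inBnj addnBA // => /andP[-> _] /andP[-> _].
rewrite -sum_phi // summxE; apply: eq_bigr => m _.
rewrite mulmx_suml summxE; apply: eq_big_seq => s s_in.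
rewrite -sum_phi // (bigD1 l) //= [X in _ + X]big1 ?addr0 => [|p pl]; last first.
  by apply: big1 => t _; rewrite /coeff_fun val_eqE (negPf pl) mul0rz.
rewrite mulmx_sumr summxE mulrz_suml; apply: eq_big_seq => t t_in.
(* Multiplicativity of [tau] is available only for words of B_{n,j}. *)
have s_B := inBnj_phi u_in s_in; have t_B := inBnj_phi v_in t_in.
rewrite /coeff_fun eqxx inBnj_cat //=; case: tau_rep => _ -> // _.
by rewrite -scalemxAl -scalemxAr !mxE !mulrzl.
Qed.

Lemma plus_rep : is_rep (n + (j - 1)) (inBnj n (j - 1)) (plus n j tau).
Proof.
split=> [|u v u_in v_in|u v u_in v_in uv]; apply/matrixP => a b.
- rewrite !mxE /phi /= /fid; case: tau_rep => tau1 _ _.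
  have -> : (a == b) = (odiv a == odiv b) && (omod a == omod b).
    by rewrite -xpair_eqE -(inj_eq (@odiv_omod_inj _ _)).
  by case: ifP => _; rewrite ?big_seq1 ?big_nil ?scale1r ?tau1 mxE.
- rewrite [LHS]mxE block_cat // summxE mxE.
  under [RHS]eq_bigr do rewrite !mxE.
  rewrite (sum_odiv_omod (fun m e => block u (odiv a) m (omod a) e *
    block v m (odiv b) e (omod b))).
  by apply: eq_bigr => m _; rewrite mxE.
- rewrite !mxE !block_wact //; apply: wact_beq; first exact: coeff_fun_class.
  by rewrite -addnBA.
Qed.

End Plus.

(** * Forgetting marked strands and counting their winding *)

(* A colouring [c] marks by [true] the positions occupied by the strands to be
   forgotten; [kept c k] counts the other strands among the first [k] positions. *)
Section Forget.
Implicit Types (c : nat -> bool) (u v w : word).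

Fixpoint kept c k := if k is k'.+1 then (kept c k' + ~~ c k')%N else 0%N.

Definition recolor i c : nat -> bool := fun p => c (swap_pos i p).

Definition recolor_word c w := foldl (fun c' (l : letter) => recolor l.1 c') c w.

(** When positions i-1 and i are both kept, [kept c i] includes position i-1 and is therefore the
    index, counted from one, of the crossing among the kept strands. *)
Fixpoint forget c w : word :=
  if w is l :: w' then
    (if ~~ c l.1.-1 && ~~ c l.1 then [:: (kept c l.1, l.2)] else [::])
    ++ forget (recolor l.1 c) w'
  else [::].

(* Each full twist of a marked strand with a kept one contributes [q]. To avoid
   a square root of [q], all of its weight is put on the crossings in which the
   marked strand enters on the left of a positive letter. *)
Fixpoint winding (q : CC) c w : CC :=
  if w is l :: w' then
    (if l.2 then if c l.1.-1 && ~~ c l.1 then q else 1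
     else if ~~ c l.1.-1 && c l.1 then q^-1 else 1)
    * winding q (recolor l.1 c) w'
  else 1.

Lemma keptS c k : kept c k.+1 = (kept c k + ~~ c k)%N.
Proof. by []. Qed.

Lemma kept_ext c c' : c =1 c' -> kept c =1 kept c'.
Proof. by move=> cc'; elim=> //= k ->; rewrite cc'. Qed.

Lemma recolor_ext i c c' : c =1 c' -> recolor i c =1 recolor i c'.
Proof. by move=> cc' p; apply: cc'. Qed.

Lemma forget_ext w c c' : c =1 c' -> forget c w = forget c' w.
Proof.
elim: w c c' => //= l w IH c c' cc'.
by rewrite !cc' (kept_ext cc') (IH _ _ (recolor_ext l.1 cc')).
Qed.

Lemma winding_ext q w c c' : c =1 c' -> winding q c w = winding q c' w.
Proof.
elim: w c c' => //= l w IH c c' cc'.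
by rewrite !cc' (IH _ _ (recolor_ext l.1 cc')).
Qed.

Lemma forget_cat c u v : forget c (u ++ v) = forget c u ++ forget (recolor_word c u) v.
Proof. by elim: u c => //= l u IH c; rewrite IH catA. Qed.

Lemma winding_cat q c u v :
  winding q c (u ++ v) = winding q c u * winding q (recolor_word c u) v.
Proof. by elim: u c => /= [|l u IH] c; rewrite ?mul1r // IH mulrA. Qed.

Lemma recolor_wordE c w p : recolor_word c w p = c (endpoint (inv_word w) p).
Proof.
elim: w c => //= l w IH c; rewrite IH -[l :: w]cat1s inv_word_cat endpoint_cat.
by [].
Qed.

Lemma endpoint_invK u : cancel (endpoint (inv_word u)) (endpoint u).
Proof. by rewrite -{2}[u]inv_wordK; apply: endpoint_inv. Qed.

Lemma beq_recolor N c u v : beq N u v -> recolor_word c u =1 recolor_word c v.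
Proof.
move=> /beq_endpoint uv p; rewrite !recolor_wordE; congr c.
by rewrite -{2}[p](endpoint_invK u) uv endpoint_inv.
Qed.

Lemma kept_recolor_lt i c k : (k < i)%N -> kept (recolor i c) k = kept c k.
Proof.
elim: k => //= k IH ki; rewrite IH; last lia.
by rewrite /recolor /swap_pos !ifN_eq //; lia.
Qed.

Lemma kept_recolor_gt i c k : (0 < i < k)%N -> kept (recolor i c) k = kept c k.
Proof.
case: i => // p /andP[_ pk]; have -> : k = (p.+2 + (k - p.+2))%N by lia.
elim: (k - p.+2)%N => [|d IH].
  by rewrite addn0 /= kept_recolor_lt // /recolor !swap_posE addnAC.
by rewrite addnS keptS IH [RHS]keptS /recolor /swap_pos !ifN_eq //; lia.
Qed.

Lemma leq_kept c : {homo kept c : k l / (k <= l)%N}.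
Proof. by apply: homo_leq => // [k l r|k]; [apply: leq_trans | apply: leq_addr]. Qed.

Lemma kept_recolor_word N c w : valid N w -> kept (recolor_word c w) N = kept c N.
Proof.
elim: w c => //= l w IH c /andP[l_ok w_ok].
by rewrite IH // kept_recolor_gt.
Qed.

Lemma kept_letter N c i : (0 < i < N)%N -> ~~ c i.-1 -> ~~ c i ->
  (0 < kept c i < kept c N)%N.
Proof.
case: i => // i /= iN /negPf ci /negPf ci1.
by have := leq_kept c iN; rewrite /= ci ci1; lia.
Qed.

Lemma valid_forget N c w : valid N w -> valid (kept c N) (forget c w).
Proof.
elim: w c => //= l w IH c /andP[l_ok w_ok].
rewrite valid_cat -{2}(@kept_recolor_gt l.1 c N) // IH // andbT.
by case: ifP => // /andP[cl cl']; rewrite /valid /= kept_letter.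
Qed.

(** * Invariance of [forget] and [winding] under the braid relations *)

Section Invariance.
Variables (q : CC) (N m : nat).
Hypothesis q_neq0 : q != 0.

(** All colourings with [m] kept strands are considered, since a prefix changes the colouring but
    not this number. *)
Definition same_forget u v := forall c, kept c N = m ->
  beq m (forget c u) (forget c v) /\ winding q c u = winding q c v.

Lemma same_forget_sym u v : same_forget u v -> same_forget v u.
Proof. by move=> uv c /uv[? ->]; split=> //; apply: beq_sym. Qed.

Lemma same_forget_free i e : (0 < i < N)%N -> same_forget [:: (i, e); (i, ~~ e)] [::].
Proof.
case: i => // p pN c cN.
have letter_ok := @kept_letter N c p.+1 pN; rewrite cN /= in letter_ok.
rewrite /= kept_recolor_lt // /recolor !swap_posE.
(* In the two mixed colourings the weights of the pair are 1 and 1, or [q] and its inverse in some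
   order. *)
case: (c p) (c p.+1) letter_ok => [] [] /= letter_ok; split; try exact: beq_refl.
- by case: e; rewrite /= !mul1r.
- by case: e; rewrite /= ?mul1r ?mulr1 ?divff.
- by case: e; rewrite /= ?mul1r ?mulr1 ?mulVf.
- by apply: beq_free; apply: letter_ok.
- by case: e; rewrite /= !mul1r.
Qed.

Lemma same_forget_comm i j : (0 < i)%N -> (i.+1 < j < N)%N ->
  same_forget [:: (i, true); (j, true)] [:: (j, true); (i, true)].
Proof.
case: i j => // p [] // r _ /andP[pr rN] c cN.
have i_ok : (0 < p.+1 < N)%N by lia.
have i_letter := @kept_letter N c p.+1 i_ok; rewrite cN /= in i_letter.
have j_letter := @kept_letter N c r.+1 rN; rewrite cN /= in j_letter.
(* When all four strands are kept, this bound makes the surviving indices differ by at least two. *)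
have kept_r : (kept c p.+2 <= kept c r)%N by apply: leq_kept; lia.
have swap_r : (swap_pos p.+1 r = r) * (swap_pos p.+1 r.+1 = r.+1).
  by rewrite /swap_pos !ifN_eq //; lia.
have swap_p : (swap_pos r.+1 p = p) * (swap_pos r.+1 p.+1 = p.+1).
  by rewrite /swap_pos !ifN_eq //; lia.
rewrite /= kept_recolor_gt ?kept_recolor_lt /recolor ?swap_r ?swap_p; try lia.
split; last by rewrite !mulr1 mulrC.
move: i_letter j_letter kept_r => /=.
case: (c p) (c p.+1) (c r) (c r.+1) => [] [] [] [] /= i_l j_l kept_r; try exact: beq_refl.
by apply: beq_comm; [apply: i_l | apply: j_l | lia].
Qed.

(** Both words cross each pair of the three strands once, with the same strand entering on the left,
    so the weights agree. Only the colouring keeping all three strands needs a braid relation. *)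
Lemma same_forget_braid i : (0 < i)%N -> (i.+1 < N)%N ->
  same_forget [:: (i, true); (i.+1, true); (i, true)]
    [:: (i.+1, true); (i, true); (i.+1, true)].
Proof.
case: i => // p _ pN c cN.
have i_ok : (0 < p.+1 < N)%N by lia.
have i_letter := @kept_letter N c p.+1 i_ok; rewrite cN /= in i_letter.
have j_letter := @kept_letter N c p.+2 pN; rewrite cN /= in j_letter.
rewrite /= !kept_recolor_lt //= /recolor !swap_posE.
move: i_letter j_letter.
case: (c p) (c p.+1) (c p.+2) => [] [] [] /= i_l j_l;
  rewrite ?mul1r ?mulr1 ?addn0; split => //; try exact: beq_refl.
by rewrite !addn1 in i_l j_l *; apply: beq_braid; [apply: i_l | apply: j_l | lia].
Qed.

Lemma beq_same_forget u v : beq N u v -> valid N u -> same_forget u v.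
Proof.
elim=> {u v}.
- by move=> u _ c _; split=> //; apply: beq_refl.
- move=> u v uv IH v_ok; apply/same_forget_sym/IH.
  by rewrite (beq_valid uv).
- move=> u v w uv IHu _ IHv u_ok c cN.
  have [uv1 ->] := IHu u_ok c cN; rewrite (beq_valid uv) in u_ok.
  have [vw1 ->] := IHv u_ok c cN; split=> //; exact: beq_trans uv1 vw1.
- move=> a b u v a_ok b_ok uv IH; rewrite !valid_cat a_ok b_ok andbT /= => u_ok c cN.
  have caN : kept (recolor_word c a) N = m by rewrite kept_recolor_word.
  have [uv1 uv2] := IH u_ok _ caN.
  (* Equivalent words have the same permutation, so the suffix [b] meets the same colouring on both
     sides. *)
  have E := beq_recolor (recolor_word c a) uv.
  rewrite !forget_cat !winding_cat -(forget_ext b E) -(winding_ext q b E) uv2.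
  split=> //; apply: beq_ctx uv1; first by rewrite -cN valid_forget.
  by rewrite -caN -(kept_recolor_word (recolor_word c a) u_ok) valid_forget.
- by move=> i e i_ok _; apply: same_forget_free.
- move=> i j i_ok j_ok ij _; have [lt_ij|le_ji] := ltnP i j.
    by apply: same_forget_comm; lia.
  by apply/same_forget_sym/same_forget_comm; lia.
- move=> i j i_ok j_ok ij _; have [E|E] : j = i.+1 \/ i = j.+1 by lia.
    by subst; apply: same_forget_braid; lia.
  by subst; apply/same_forget_sym/same_forget_braid; lia.
Qed.

End Invariance.
End Forget.

(** * The initial representation of B_{n,m} *)

Section ForgetRep.
Variables (n m d : nat) (rho : word -> 'M[CC]_d) (q : CC).
Hypothesis rho_rep : is_rep m (valid m) rho.

Definition first_strands (p : nat) := (p < n)%N.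

Definition forget_rep w : 'M[CC]_d :=
  winding q first_strands w *: rho (forget first_strands w).

Lemma kept_first k : kept first_strands k = (k - n)%N.
Proof. by elim: k => //= k ->; rewrite /first_strands; case: ltnP; lia. Qed.

(** Membership gives one implication. For the other, an injective self-map of the first [n]
    positions is onto, so no further strand can end there. *)
Lemma endpoint_lt u k : inBnj n m u -> (endpoint u k < n)%N = (k < n)%N.
Proof.
case/andP=> _ /forallP u_n.
pose f (i : 'I_n) : 'I_n := Ordinal (u_n i).
have f_inj : injective f.
  by move=> i j [ij]; apply: val_inj; apply: (can_inj (endpoint_inv u)).
apply/idP/idP => [uk|kn]; last exact: u_n (Ordinal kn).
have /codomP[i [Ei]] := injF_onto f_inj (Ordinal uk).
by rewrite (can_inj (endpoint_inv u) Ei).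
Qed.

(** This invariance of the colouring makes [forget] and [winding] multiplicative on B_{n,m}. *)
Lemma recolor_first u : inBnj n m u -> recolor_word first_strands u =1 first_strands.
Proof.
move=> u_in p; rewrite recolor_wordE /first_strands.
by rewrite -(endpoint_lt _ u_in) endpoint_invK.
Qed.

Lemma valid_forget_first u : inBnj n m u -> valid m (forget first_strands u).
Proof.
by case/andP=> /(valid_forget first_strands); rewrite kept_first addKn.
Qed.

Lemma forget_rep_rep : q != 0 -> is_rep (n + m) (inBnj n m) forget_rep.
Proof.
move=> q_neq0; case: rho_rep => rho1 rhoM rho_beq; split=> [|u v u_in v_in|u v u_in v_in uv].
- by rewrite /forget_rep /= rho1 scale1r.
- rewrite /forget_rep forget_cat winding_cat (forget_ext _ (recolor_first u_in)).
  rewrite (winding_ext _ _ (recolor_first u_in)) rhoM ?valid_forget_first //.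
  by rewrite -scalemxAl -scalemxAr scalerA.
- have [u_ok _] := andP u_in.
  have [|uv1 uv2] := beq_same_forget (m := m) q_neq0 uv u_ok (c := first_strands).
    by rewrite kept_first addKn.
  by rewrite /forget_rep uv2 (rho_beq _ _ _ _ uv1) ?valid_forget_first.
Qed.

Lemma forget_rep_low i : (1 <= i <= n - 1)%N -> forget_rep [:: (i, true)] = 1%:M.
Proof.
move=> i_ok; have [i1 i2] : (i.-1 < n)%N /\ (i < n)%N by lia.
case: rho_rep => rho1 _ _.
by rewrite /forget_rep /= /first_strands i1 i2 /= mulr1 rho1 scale1r.
Qed.

(** The marked strand enters the first crossing on the left, with weight [q], and the second on the
    right, with weight 1; no letter survives. *)
Lemma forget_rep_mid : (0 < n)%N -> forget_rep [:: (n, true); (n, true)] = q%:M.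
Proof.
move=> n_gt0; have n1 : (n.-1 < n)%N by lia.
case: rho_rep => rho1 _ _.
rewrite /forget_rep /= /recolor /first_strands /swap_pos !eqxx.
by rewrite [n == n.-1]gtn_eqF // n1 ltnn /= !mulr1 rho1 scalemx1.
Qed.

Lemma forget_rep_high i : (1 <= i <= m - 1)%N ->
  forget_rep [:: ((n + i)%N, true)] = rho [:: (i, true)].
Proof.
move=> i_ok; have [i1 i2] : ((n + i).-1 < n)%N = false /\ (n + i < n)%N = false by lia.
by rewrite /forget_rep /= kept_first addKn /first_strands i1 i2 /= mulr1 scale1r.
Qed.

End ForgetRep.

(** * Iterating [plus], and the resulting dimension *)

Lemma iter_dimE n m d s : (s <= m)%N ->
  iter_dim n m d s = ((\prod_(n + m - s <= i < n + m) i) * d)%N.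
Proof.
elim: s => [|s IH] sm /=; first by rewrite subn0 big_geq // mul1n.
rewrite IH; last lia.
rewrite [in RHS]big_ltn; last lia.
by rewrite mulnA; congr (_ * \prod_(_ <= i < _) _ * _)%N; lia.
Qed.

Lemma iter_rep_rep n m d (rho' : word -> 'M[CC]_d) s :
  is_rep (n + m) (inBnj n m) rho' -> (s <= m)%N ->
  is_rep (n + (m - s)) (inBnj n (m - s)) (iter_rep n m rho' s).
Proof.
move=> rho'_rep; elim: s => [|s IH] sm; first by rewrite subn0.
have -> : (m - s.+1 = m - s - 1)%N by lia.
by apply: plus_rep; [lia | apply: IH; lia].
Qed.

Theorem theorem5p3 (n m d : nat) (rho : word -> 'M[CC]_d) (q : CC) :
  (2 <= n)%N -> (1 <= m)%N -> q != 0 ->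
  is_rep m (valid m) rho ->
  exists rho' : word -> 'M[CC]_d,
    [/\ is_rep (n + m) (inBnj n m) rho',
        (forall i, (1 <= i <= n - 1)%N -> rho' [:: (i, true)] = 1%:M),
        rho' [:: (n, true); (n, true)] = q%:M,
        (forall i, (1 <= i <= m - 1)%N -> rho' [:: ((n + i)%N, true)] = rho [:: (i, true)]) &
        (forall s, (s <= m)%N -> is_rep (n + (m - s)) (inBnj n (m - s)) (iter_rep n m rho' s)) /\
        iter_dim n m d m = ((\prod_(n <= i < n + m) i) * d)%N].
Proof.
move=> n_ge2 _ q_neq0 rho_rep; exists (forget_rep n rho q).
have rho'_rep := forget_rep_rep n rho_rep q_neq0.
split=> // [i i_ok||i i_ok|].
- exact: (forget_rep_low q rho_rep i_ok).
- by apply: (forget_rep_mid q rho_rep); lia.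
- exact: (forget_rep_high n rho q i_ok).
- by split=> [s|]; [apply: iter_rep_rep | rewrite iter_dimE // addnK].
Qed.
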